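(* Let $G$ be a connected $k$-uniform hypergraph with $k$ even, and suppose $G$ is not odd-bipartite. Then the following are equivalent: (1) $\rho^{\mathcal{L}}(G)=\rho^{\mathcal{Q}}(G)$; (2) there is a complex diagonal matrix $\Gamma$ whose diagonal entries all have modulus $1$ such that $\mathcal{L}(G)=\Gamma^{-(k-1)}\mathcal{Q}(G)\Gamma$; (3) $\mathrm{Spec}(\mathcal{L}(G))=\mathrm{Spec}(\mathcal{Q}(G))$; (4) there is a complex diagonal matrix $\Gamma$ whose diagonal entries all have modulus $1$ such that $-\mathcal{A}(G)=\Gamma^{-(k-1)}\mathcal{A}(G)\Gamma$; (5) $\mathrm{Spec}(\mathcal{A}(G))=-\mathrm{Spec}(\mathcal{A}(G))$; (6) $-\rho^{\mathcal{A}}(G)\in\mathrm{Spec}(\mathcal{A}(G))$. Moreover, any diagonal matrix $\Gamma$ as in (2) or (4) is necessarily non-real.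
   Context: Tensors: for a real order-$k$, dimension-$n$ tensor $\mathcal{T}$ and $x\in\mathbb{C}^n$, $(\mathcal{T}x^{k-1})_i=\sum_{i_2,\dots,i_k}t_{ii_2\dots i_k}x_{i_2}\cdots x_{i_k}$; $\lambda\in\mathbb{C}$ is an eigenvalue with eigenvector $x\ne0$ if $\mathcal{T}x^{k-1}=\lambda x^{[k-1]}$, $x^{[k-1]}=(x_i^{k-1})_i$. $\mathrm{Spec}(\mathcal{T})$ is the set of eigenvalues and $\rho$ the spectral radius. For a nonsingular diagonal matrix $\Gamma=\mathrm{diag}(\gamma_1,\dots,\gamma_n)$, $\Gamma^{-(k-1)}\mathcal{T}\Gamma$ is the tensor with entries $\gamma_{i_1}^{-(k-1)}t_{i_1i_2\dots i_k}\gamma_{i_2}\cdots\gamma_{i_k}$. Hypergraphs: degree $d_v$ = number of edges containing $v$. For a $k$-uniform hypergraph on $v_1,\dots,v_n$, the adjacency tensor $\mathcal{A}$ has $a_{i_1\dots i_k}=\frac{1}{(k-1)!}$ if $\{v_{i_1},\dots,v_{i_k}\}$ is an edge, else $0$; $\mathcal{D}$ diagonal with $d_{i\dots i}=d_{v_i}$; $\mathcal{L}=\mathcal{D}-\mathcal{A}$, $\mathcal{Q}=\mathcal{D}+\mathcal{A}$; $\rho^{\mathcal{A}},\rho^{\mathcal{L}},\rho^{\mathcal{Q}}$ denote their spectral radii. An even-uniform hypergraph is odd-bipartite if its vertex set has a bipartition $V_1\cup V_2$ such that every edge has an odd number of vertices in each of $V_1$ and $V_2$. *)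

(* Defs.v *)
From mathcomp Require Import all_boot all_order all_algebra.
From mathcomp Require Import boolp classical_sets reals.
From mathcomp Require Export complex.

Set Implicit Arguments.
Unset Strict Implicit.
Unset Printing Implicit Defensive.

Import Order.TTheory GRing.Theory Num.Theory.

Local Open Scope ring_scope.
Local Open Scope complex_scope.
Local Open Scope classical_set_scope.

(* Order-k (k >= 1), dimension-n tensors.  The first index is kept apart from
   the other k - 1 ones: t_{i i_2 ... i_k} is [T (i, t)] with
   [t = [tuple i_2; ...; i_k]]. *)
Definition tensor (F : Type) (k n : nat) :=
  {ffun 'I_n * k.-1.-tuple 'I_n -> F}.

Section Tensor.
Context {F : fieldType} {k n : nat}.

(* T x^{k-1} *)
Definition tensor_app (T : tensor F k n) (x : 'cV[F]_n) : 'cV[F]_n :=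
  \col_i \sum_(t : k.-1.-tuple 'I_n)
     T (i, t) * \prod_(j < k.-1) x (tnth t j) 0.

(* x^{[m]} *)
Definition hadamard_pow (x : 'cV[F]_n) (m : nat) : 'cV[F]_n :=
  \col_i (x i 0 ^+ m).

Definition is_eigenpair (T : tensor F k n) (lambda : F) (x : 'cV[F]_n) : Prop :=
  x != 0 /\ tensor_app T x = lambda *: hadamard_pow x k.-1.

Definition Spec (T : tensor F k n) : set F :=
  [set lambda | exists x : 'cV[F]_n, is_eigenpair T lambda x].

(* Gamma^{-(k-1)} T Gamma, meant for a nonsingular diagonal matrix Gamma *)
Definition diag_conj (Gamma : 'M[F]_n) (T : tensor F k n) : tensor F k n :=
  [ffun it : 'I_n * k.-1.-tuple 'I_n => Gamma it.1 it.1 ^- k.-1 * T it *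
     \prod_(j < k.-1) Gamma (tnth it.2 j) (tnth it.2 j)].

End Tensor.

(* The supremum is a maximum whenever the spectrum is finite and nonempty. *)
Definition spectral_radius (R : realType) (k n : nat)
    (T : tensor R[i] k n) : R :=
  sup [set Normc.normc z | z in Spec T].

Definition unimodular_diag (C : numFieldType) (n : nat) (Gamma : 'M[C]_n) : Prop :=
  is_diag_mx Gamma /\ forall i, `|Gamma i i| = 1.

Local Close Scope classical_set_scope.

(* A hypergraph on the vertices v_0, ..., v_(n-1) is given by its edge set. *)
Section Hypergraph.
Context {n : nat}.
Implicit Type E : {set {set 'I_n}}.

Definition uniform (k : nat) E : Prop := forall e, e \in E -> #|e| = k.

Definition coedge E : rel 'I_n :=
  fun u v => [exists e in E, (u \in e) && (v \in e)].

Definition connected_hypergraph E : Prop := forall u v, connect (coedge E) u v.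

(* V1 and V2 may be empty a priori; they are nonempty as soon as there is an
   edge. *)
Definition odd_bipartite E : Prop :=
  exists V1 V2 : {set 'I_n},
    [/\ V1 :|: V2 = [set: 'I_n], [disjoint V1 & V2] &
        forall e, e \in E -> odd #|e :&: V1| /\ odd #|e :&: V2|].

Definition degree E (v : 'I_n) : nat := #|[set e in E | v \in e]|.

End Hypergraph.

Section HypergraphTensors.
Variables (F : fieldType) (k n : nat) (E : {set {set 'I_n}}).

Definition adjacency_tensor : tensor F k n :=
  [ffun it : 'I_n * k.-1.-tuple 'I_n => if [set v in it.1 :: val it.2] \in E
              then (k.-1)`!%:R^-1 else 0].

Definition degree_tensor : tensor F k n :=
  [ffun it : 'I_n * k.-1.-tuple 'I_n => if all (pred1 it.1) it.2 then (degree E it.1)%:R else 0].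

Definition laplacian_tensor : tensor F k n := degree_tensor - adjacency_tensor.

Definition signless_laplacian_tensor : tensor F k n :=
  degree_tensor + adjacency_tensor.

End HypergraphTensors.

(* Main.v *)
Require Import Defs.
From mathcomp Require Import all_boot all_order all_algebra.
From mathcomp Require Import boolp classical_sets functions reals.
From mathcomp Require Import topology normedtype derive realfun.
From mathcomp Require Import ring lra.

(* A nonnegative weakly irreducible tensor T has a positive eigenvector: among
   the pairs (r, x) with x > 0 and T x^{k-1} <= r x^{[k-1]}, weak irreducibility
   confines the normalised x to a compact box, so a least r exists; if some but
   not all of its inequalities are strict, lowering a strict coordinate makes
   more of them strict, and if all are strict, r can be lowered.
   If |S| <= T entrywise, the moduli y = |x| of an eigenvector x of S for mu
   satisfy |mu| y^{[k-1]} <= T y^{k-1}. Comparing y with the Perron vector gives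
   |mu| <= rho(T), and in the equality case y is proportional to that vector
   and all triangle inequalities are equalities, so that
   S = (mu / |mu|) Gamma^{-(k-1)} T Gamma with Gamma unimodular. This is applied
   to (S, T) = (L, Q), where the diagonal entries force mu = |mu|, and to
   (S, T) = (A, A) with mu = - rho(A). A real Gamma has entries 1 and -1, and
   - A = Gamma^{-(k-1)} A Gamma makes their product over each edge equal to -1,
   which is an odd bipartition. *)

Set Implicit Arguments.
Unset Strict Implicit.
Unset Printing Implicit Defensive.

Import Order.TTheory GRing.Theory Num.Theory.
Import numFieldNormedType.Exports.

Local Open Scope ring_scope.
Local Open Scope complex_scope.
Local Open Scope classical_set_scope.

(** * Continuity and compactness in finite products *)

(** By Tychonoff a product of segments is compact for the pointwise topology, hence so is a closed
    subset of it, and the extreme value theorem applies. *)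
Lemma closed_box_max (R : realType) (I : eqType) (a b : I -> R)
    (K : set ({ptws I -> R})) (g : {ptws I -> R} -> R) :
    closed K -> continuous g -> K !=set0 ->
    (forall f, K f -> forall i, a i <= f i <= b i) ->
  exists2 f, K f & forall h, K h -> g h <= g f.
Proof.
move=> clK cg K0 Kbox.
have cK : compact K.
  have := @tychonoff I (fun _ => R) (fun i => `[a i, b i])
    (fun i => @segment_compact R (a i) (b i)).
  move/(subclosed_compact clK); apply => f Kf i /=.
  by rewrite in_itv /=; exact: Kbox.
have [f fK fmax] := compact_EVT_max K0 cK (continuous_subspaceT cg).
by exists f => [|h Kh]; [exact/set_mem | apply: fmax; exact/mem_set].
Qed.

Lemma continuous_coord (R : realType) (I : eqType) (i : I) :
  continuous (fun f : {ptws I -> R} => f i).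
Proof. exact: (@proj_continuous I (fun _ => R) i). Qed.

Lemma continuous_add (R : realType) (T : topologicalType) (f g : T -> R) :
  continuous f -> continuous g -> continuous (fun x => f x + g x).
Proof. by move=> cf cg x; apply: cvgD; [exact: cf | exact: cg]. Qed.

Lemma continuous_mul (R : realType) (T : topologicalType) (f g : T -> R) :
  continuous f -> continuous g -> continuous (fun x => f x * g x).
Proof. by move=> cf cg x; apply: cvgM; [exact: cf | exact: cg]. Qed.

Lemma continuous_expr (R : realType) (T : topologicalType) (f : T -> R) m :
  continuous f -> continuous (fun x => f x ^+ m).
Proof.
move=> cf x; apply: (@continuous_comp _ _ _ f (fun y => y ^+ m)); first exact: cf.
exact: exprn_continuous.
Qed.

Lemma continuous_sum (R : realType) (T : topologicalType) (J : Type) (s : seq J)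
    (P : pred J) (F : J -> T -> R) :
    (forall j, P j -> continuous (F j)) ->
  continuous (fun x => \sum_(j <- s | P j) F j x).
Proof. by move=> cF; apply: continuous_big => // x; apply: cvgD; [exact: cvg_fst|exact: cvg_snd]. Qed.

Lemma continuous_prod (R : realType) (T : topologicalType) (J : Type) (s : seq J)
    (P : pred J) (F : J -> T -> R) :
    (forall j, P j -> continuous (F j)) ->
  continuous (fun x => \prod_(j <- s | P j) F j x).
Proof. by move=> cF; apply: continuous_big => // x; apply: cvgM; [exact: cvg_fst|exact: cvg_snd]. Qed.

Lemma closed_le_fun (R : realType) (T : topologicalType) (f g : T -> R) :
  continuous f -> continuous g -> closed [set x | f x <= g x].
Proof.
move=> cf cg.
rewrite (_ : [set _ | _] = (f \- g) @^-1` [set y | y <= 0]).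
  apply: preimage_closed; last exact: closed_le.
  by move=> x _; apply: continuousB; [exact: cf|exact: cg].
by apply/seteqP; split => x /=; rewrite subr_le0.
Qed.

Lemma closed_forall (T : topologicalType) (J : Type) (P : J -> set T) :
  (forall j, closed (P j)) -> closed [set x | forall j, P j x].
Proof.
move=> cP; rewrite (_ : [set _ | _] = \bigcap_j P j).
  by apply: closed_bigI => j _; exact: cP.
by apply/seteqP; split=> [x Px j _|x Px j]; exact: Px.
Qed.

(** * Perron vectors of weakly irreducible tensors *)

Lemma tensor_appE (F : fieldType) (k n : nat) (T : tensor F k n) x i :
  tensor_app T x i 0 =
  \sum_(t : k.-1.-tuple 'I_n) T (i, t) * \prod_(j < k.-1) x (tnth t j) 0.
Proof. by rewrite mxE. Qed.

Lemma tensor_appZ (F : fieldType) (k n : nat) (T : tensor F k n) c x :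
  tensor_app T (c *: x) = c ^+ k.-1 *: tensor_app T x.
Proof.
apply/colP=> i; rewrite !mxE mulr_sumr; apply: eq_bigr => t _.
rewrite mulrCA; congr (_ * _).
under eq_bigr do rewrite mxE.
by rewrite big_split /= prodr_const card_ord.
Qed.

(* Strong connectedness of the digraph with an arc from i to each entry of t
   whenever T (i, t) != 0, phrased through vertex cuts. *)
Definition weakly_irreducible (F : fieldType) (k n : nat) (T : tensor F k n) :=
  forall (P : pred 'I_n) (i0 j0 : 'I_n), P i0 -> ~~ P j0 ->
  exists i (t : k.-1.-tuple 'I_n) j,
    [/\ P i, ~~ P j, j \in t & T (i, t) != 0].

Lemma tensor_app_ge0 (R : realFieldType) (k n : nat) (T : tensor R k n)
    (x : 'cV[R]_n) i :
    (forall it, 0 <= T it) -> (forall j, 0 <= x j 0) ->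
  0 <= tensor_app T x i 0.
Proof.
move=> T0 x0; rewrite tensor_appE; apply: sumr_ge0 => t _.
by rewrite mulr_ge0 // prodr_ge0.
Qed.

Lemma tensor_app_le (R : realFieldType) (k n : nat) (T : tensor R k n)
    (x y : 'cV[R]_n) i :
    (forall it, 0 <= T it) -> (forall j, 0 <= x j 0 <= y j 0) ->
  tensor_app T x i 0 <= tensor_app T y i 0.
Proof.
move=> T0 xy; rewrite !tensor_appE; apply: ler_sum => t _.
by rewrite ler_wpM2l // ler_prod.
Qed.

(** All terms are monotone in the vector. The term of [t] grows strictly, because its coefficient is
    positive and its factor at [l] increases while the other factors of [y] are positive. *)
Lemma tensor_app_lt (R : realFieldType) (k n : nat) (T : tensor R k n)
    (x y : 'cV[R]_n) i t l :
    (forall it, 0 <= T it) -> (forall j, 0 <= x j 0 <= y j 0) ->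
    (forall j, 0 < y j 0) -> T (i, t) != 0 -> l \in val t -> x l 0 < y l 0 ->
  tensor_app T x i 0 < tensor_app T y i 0.
Proof.
move=> T0 xy y0 Tit /tnthP[j0 lE] xyl.
rewrite !tensor_appE (bigD1 t) //= [ltRHS](bigD1 t) //=.
apply: ltr_leD; last first.
  by apply: ler_sum => s _; rewrite ler_wpM2l // ler_prod.
rewrite ltr_pM2l; last by rewrite lt0r Tit T0.
rewrite (bigD1 j0) //= [ltRHS](bigD1 j0) //= -lE.
(* Entries of [x] may vanish, so the other factors are first raised to those of [y]; only then is
   the factor at [l] compared strictly. *)
apply: (@le_lt_trans _ _ (x l 0 * \prod_(j < k.-1 | j != j0) y (tnth t j) 0)).
  by rewrite ler_wpM2l ?ler_prod //; have /andP[] := xy l.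
by rewrite ltr_pM2r // prodr_gt0.
Qed.

(** Keep only the term of [t], and in it drop all factors but one occurrence of [x l 0]: each of
    them is at least 1. *)
Lemma le_tensor_app (R : realFieldType) (k n : nat) (T : tensor R k n)
    (x : 'cV[R]_n) i t l :
    (forall it, 0 <= T it) -> (forall j, 1 <= x j 0) -> l \in val t ->
  T (i, t) * x l 0 <= tensor_app T x i 0.
Proof.
move=> T0 x1 /tnthP[j0 lE].
have x0 j : 0 <= x j 0 by rewrite (le_trans ler01).
rewrite tensor_appE (bigD1 t) //= -[leLHS]addr0 lerD //; last first.
  by apply: sumr_ge0 => s _; rewrite mulr_ge0 // prodr_ge0.
rewrite ler_wpM2l // (bigD1 j0) //= -lE ler_peMr //.
have : \prod_(j < k.-1 | j != j0) 1 <= \prod_(j < k.-1 | j != j0) x (tnth t j) 0.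
  by apply: ler_prod => j _; rewrite ler01 x1.
by rewrite big1.
Qed.

(** The feasible pairs of the Collatz-Wielandt minimisation, whose least [r] turns out to be the
    Perron eigenvalue. *)
Definition supereigen (R : realFieldType) (k n : nat) (T : tensor R k n) r
    (x : 'cV[R]_n) : Prop :=
  forall i, 0 < x i 0 /\ tensor_app T x i 0 <= r * x i 0 ^+ k.-1.

Lemma supereigenZ (R : realFieldType) (k n : nat) (T : tensor R k n) r c
    (x : 'cV[R]_n) :
  0 < c -> supereigen T r x -> supereigen T r (c *: x).
Proof.
move=> c0 rx i; have [xi0 le_i] := rx i; split; first by rewrite mxE mulr_gt0.
by rewrite tensor_appZ [leLHS]mxE [in leRHS]mxE exprMn mulrCA ler_wpM2l // exprn_ge0 // ltW.
Qed.

Lemma supereigen_ge0 (R : realFieldType) (k n : nat) (T : tensor R k n) r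
    (x : 'cV[R]_n) :
  (0 < n)%N -> (forall it, 0 <= T it) -> supereigen T r x -> 0 <= r.
Proof.
move=> n0 T0 rx; have [x0 le0] := rx (Ordinal n0).
have := le_trans (tensor_app_ge0 (Ordinal n0) T0 (fun j => ltW (rx j).1)) le0.
by rewrite pmulr_lge0 // exprn_gt0.
Qed.

(** A quantitative form of continuity: scale [x] by [1 - eta] and bound [(1 - eta) ^+ m] below by
    Bernoulli's inequality. *)
Lemma expr_lt_decr (R : realFieldType) (m : nat) (a r x : R) :
    0 <= a -> 0 < x -> a < r * x ^+ m ->
  exists2 y, 0 < y < x & a < r * y ^+ m.
Proof.
move=> a0 x0; set b := r * x ^+ m => ab; have b0 : 0 < b by apply: le_lt_trans ab.
(* Bernoulli costs at most [b * eta * m], which is less than [b - a]. The summand 2 in [m.+2] keeps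
   [eta < 1] even when [a = 0] and [m = 0]. *)
pose eta := (b - a) / (b * m.+2%:R).
have bernoulli (e : R) p : 0 <= e <= 1 -> 1 - e * p%:R <= (1 - e) ^+ p.
  move=> /andP[e0 e1]; elim: p => [|p IH]; first by rewrite mulr0 subr0 expr0.
  have p0 : 0 <= p%:R :> R by [].
  by rewrite exprS -natr1; nra.
have m0 : 0 <= m%:R :> R by [].
have c0 : 0 < b * m.+2%:R by rewrite mulr_gt0.
have etaE : eta * (b * m.+2%:R) = b - a by rewrite divfK // gt_eqF.
have eta0 : 0 < eta by rewrite divr_gt0 // subr_gt0.
have eta1 : eta < 1.
  rewrite ltr_pdivrMr // mul1r -addn2 natrD; nra.
exists (x * (1 - eta)).
  by rewrite pmulr_rgt0 // subr_gt0 eta1 gtr_pMr // gtrBl.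
have bern : 1 - eta * m%:R <= (1 - eta) ^+ m by apply: bernoulli; rewrite !ltW.
rewrite exprMn mulrA -/b.
apply: lt_le_trans (ler_wpM2l (ltW b0) bern).
by move: etaE; rewrite -addn2 natrD; nra.
Qed.

Definition strict_idx (R : realFieldType) (k n : nat) (T : tensor R k n) r
    (x : 'cV[R]_n) : {set 'I_n} :=
  [set i | tensor_app T x i 0 < r * x i 0 ^+ k.-1]%SET.

(* Lowering a strict coordinate keeps it strict and makes its neighbours strict. *)
Lemma supereigen_improve (R : realFieldType) (k n : nat) (T : tensor R k n) r
    (x : 'cV[R]_n) (i0 j0 : 'I_n) :
    (forall it, 0 <= T it) -> weakly_irreducible T -> supereigen T r x ->
    i0 \in strict_idx T r x -> j0 \notin strict_idx T r x ->
  exists2 x', supereigen T r x' & (#|strict_idx T r x| < #|strict_idx T r x'|)%N.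
Proof.
move=> T0 Tirr rx si0 sj0.
(* The cut is taken around the non-strict coordinates: some non-strict [j] has an arc to a strict
   [i], which is the coordinate to lower. *)
have [j [t [i [sj /negPn si it Tjt]]]] :=
  Tirr [pred j | j \notin strict_idx T r x] j0 i0 sj0 (introN negP (fun h => h si0)).
have := si; rewrite inE => lt_i.
(* The new value [y] stays strict against the old value of T x^{k-1} at [i], hence also against the
   new one, which is no larger. *)
have [y /andP[y0 yx] lt_y] :=
  expr_lt_decr (tensor_app_ge0 i T0 (fun j => ltW (rx j).1)) (rx i).1 lt_i.
pose x' : 'cV[R]_n := \col_l (if l == i then y else x l 0).
have x'E l : x' l 0 = if l == i then y else x l 0 by rewrite mxE.
have x'x l : 0 < x' l 0 <= x l 0.
  by rewrite x'E; case: eqP => [->|_]; [rewrite y0 ltW | rewrite (rx l).1 lexx].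
have le_app l : tensor_app T x' l 0 <= tensor_app T x l 0.
  by apply: tensor_app_le => // l'; have /andP[/ltW -> ->] := x'x l'.
have x'j : x' j 0 = x j 0.
  by rewrite x'E; case: eqP => // ji; rewrite /= ji si in sj.
have sub_s : (strict_idx T r x \subset strict_idx T r x')%SET.
  apply/fintype.subsetP => l; rewrite !inE => lt_l; rewrite x'E.
  by case: eqP => [->|_]; exact: le_lt_trans (le_app _) _.
exists x'.
  move=> l; split; first by have /andP[] := x'x l.
  apply: le_trans (le_app l) _; rewrite x'E.
  by case: eqP => [->|_]; [exact: ltW | exact: (rx l).2].
apply: proper_card; rewrite properE sub_s /=.
apply/subsetPn; exists j => //; rewrite inE x'j.
apply: lt_le_trans (rx j).2.
apply: (tensor_app_lt (l := i) T0 _ _ Tjt it) => [l|l|].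
- by have /andP[/ltW -> ->] := x'x l.
- exact: (rx l).1.
- by rewrite x'E eqxx.
Qed.

(** Induction on the number of non-strict coordinates: in the mixed case [supereigen_improve] lowers
    it. *)
Lemma supereigen_dichotomy (R : realFieldType) (k n : nat) (T : tensor R k n) r
    (x : 'cV[R]_n) :
    (forall it, 0 <= T it) -> weakly_irreducible T -> supereigen T r x ->
  exists2 x', supereigen T r x' &
    (forall i, i \in strict_idx T r x') \/ (forall i, i \notin strict_idx T r x').
Proof.
move=> T0 Tirr.
have [d] := ubnP (n - #|strict_idx T r x|); elim: d x => // d IH x leq_d rx.
have [all_s|/forallPn[j0 sj0]] := boolP [forall i, i \in strict_idx T r x].
  by exists x => //; left; exact/forallP.
have [all_ns|/forallPn[i0 /negPn si0]] := boolP [forall i, i \notin strict_idx T r x].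
  by exists x => //; right; exact/forallP.
have [x' rx' lt_s] := supereigen_improve T0 Tirr rx si0 sj0.
apply: IH rx'; move: leq_d; rewrite !ltnS; apply: leq_trans.
rewrite ltn_sub2l // (leq_trans lt_s) //.
by rewrite -[leqRHS]card_ord max_card.
Qed.

(** The new [r'] is the largest of the finitely many quotients (T x^{k-1})_i / x_i^{k-1}, all of
    which are below [r]. *)
Lemma supereigen_all_strict (R : realFieldType) (k n : nat) (T : tensor R k n) r
    (x : 'cV[R]_n) :
    (0 < n)%N -> supereigen T r x -> (forall i, i \in strict_idx T r x) ->
  exists2 r', r' < r & supereigen T r' x.
Proof.
move=> n0 rx sx.
pose q i := tensor_app T x i 0 / x i 0 ^+ k.-1.
have xk0 i : 0 < x i 0 ^+ k.-1 by rewrite exprn_gt0 // (rx i).1.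
pose i0 := [arg max_(i > Ordinal n0) q i]%O.
exists (q i0).
  by rewrite /q ltr_pdivrMr //; have := sx i0; rewrite inE.
move=> i; split; first exact: (rx i).1.
rewrite -ler_pdivrMr // -/(q i) /i0.
by case: arg_maxP => // j _; apply.
Qed.

(** An arc from i to j through t gives T(i,t) x_j <= (T x^{k-1})_i <= r x_i^{k-1}, so a bound on x_i
    yields one on x_j. Starting from a coordinate equal to 1, bounds spread along arcs to all
    coordinates. *)
Lemma weakly_irreducible_bound (R : realFieldType) (k n : nat) (T : tensor R k n) r :
    (0 < n)%N -> 0 <= r -> (forall it, 0 <= T it) -> weakly_irreducible T ->
  exists M, forall x : 'cV[R]_n, supereigen T r x -> (forall i, 1 <= x i 0) ->
    (exists i, x i 0 = 1) -> forall i, x i 0 <= M.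
Proof.
(* Zero entries have inverse 0 here, so [C] is at least the inverse of every nonzero entry. *)
move=> n0 r0 T0 Tirr; pose C : R := \sum_it (T it)^-1.
have C0 : 0 <= C by apply: sumr_ge0 => it _; rewrite invr_ge0.
have leC it : T it != 0 -> 1 <= C * T it.
  move=> Tit; rewrite -ler_pdivrMr ?lt0r ?Tit ?T0 // mul1r /C (bigD1 it) //=.
  by rewrite lerDl sumr_ge0 // => it' _; rewrite invr_ge0.
(* The bound [c] depends on [d] only, not on [x]. For [d = n] the second alternative is impossible,
   as there are only n coordinates. *)
suff /(_ n)[M [M1 HM]] : forall d, exists c, 1 <= c /\ forall x : 'cV[R]_n,
    supereigen T r x -> (forall i, 1 <= x i 0) -> (exists i, x i 0 = 1) ->
    [forall i, x i 0 <= c] \/ (d < #|[set i | (x i 0 <= c)%R]%SET|)%N.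
  exists M => x rx x1 ex1 i; have [/forallP //|] := HM x rx x1 ex1.
  by rewrite ltnNge -[leqRHS]card_ord max_card.
elim=> [|d [c [c1 IH]]].
  exists 1; split=> // x rx x1 [i xi]; right.
  by apply/card_gt0P; exists i; rewrite inE xi.
(* The first summand retains the coordinates already bounded by [c]; the second bounds a coordinate
   reached from them by one arc. *)
exists (c + C * r * c ^+ k.-1).
have c0 : 0 <= c by exact: le_trans ler01 c1.
have Cr0 : 0 <= C * r * c ^+ k.-1 by rewrite !mulr_ge0 ?exprn_ge0.
split=> [|x rx x1 ex1]; first by rewrite -[leLHS]addr0 lerD.
have cc' : c <= c + C * r * c ^+ k.-1 by rewrite lerDl.
have [/forallP all_c|] := boolP [forall i, x i 0 <= c].
  by left; apply/forallP => i; exact: le_trans cc'.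
move=> /[dup] nall /forallPn[j0 xj0]; right.
have [i0 xi0] := ex1.
have Pi0 : x i0 0 <= c by rewrite xi0.
have [i [t [j [xi xj jt Tit]]]] := Tirr [pred i | x i 0 <= c] i0 j0 Pi0 xj0.
have [/(negP nall) //|lt_d] := IH x rx x1 ex1.
apply: leq_trans (proper_card (A := [set i | (x i 0 <= c)%R]%SET) _) => //.
rewrite properE; apply/andP; split.
  by apply/fintype.subsetP => l; rewrite !inE => /le_trans; apply.
apply/subsetPn; exists j; rewrite !inE //.
have le1 : x j 0 <= C * (T (i, t) * x j 0).
  by rewrite mulrA ler_peMl ?leC // (le_trans ler01).
apply: le_trans le1 _.
have le2 : C * r * c ^+ k.-1 <= c + C * r * c ^+ k.-1 by rewrite lerDr.
apply: le_trans le2; rewrite -mulrA ler_wpM2l //.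
apply: le_trans (le_tensor_app i T0 x1 jt) _.
apply: le_trans (rx i).2 _.
by rewrite ler_wpM2l // lerXn2r // nnegrE (le_trans _ (x1 i)).
Qed.

Lemma closed_box (R : realType) (I : eqType) (a b : I -> R) :
  closed [set f : {ptws I -> R} | forall i, a i <= f i <= b i].
Proof.
apply: closed_forall => i.
rewrite [X in closed X](_ : _ = [set f : {ptws I -> R} | a i <= f i] `&`
                           [set f : {ptws I -> R} | f i <= b i]).
  by apply: closedI; apply: closed_le_fun;
    [exact: cst_continuous | exact: continuous_coord |
     exact: continuous_coord | exact: cst_continuous].
by apply/seteqP; split=> f /= => [/andP[]|[-> ->]].
Qed.

Lemma supereigen_exists (R : realFieldType) (k n : nat) (T : tensor R k n) :
    (0 < n)%N -> (forall it, 0 <= T it) ->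
  exists r, supereigen T r (const_mx 1).
Proof.
move=> n0 T0; exists (\sum_i tensor_app T (const_mx 1) i 0) => i.
rewrite mxE ltr01 expr1n mulr1; split=> //.
rewrite (bigD1 i) //= lerDl sumr_ge0 // => j _.
by apply: tensor_app_ge0 => // l; rewrite mxE.
Qed.

Lemma supereigen_normalize (R : realFieldType) (k n : nat) (T : tensor R k n) r
    (x : 'cV[R]_n) :
    (0 < n)%N -> supereigen T r x ->
  exists2 y : 'cV[R]_n, supereigen T r y &
    (forall i, 1 <= y i 0) /\ exists i, y i 0 = 1.
Proof.
move=> n0 rx; pose i0 := [arg min_(i < Ordinal n0) x i 0]%O.
have xi0 : 0 < x i0 0 by rewrite (rx i0).1.
exists ((x i0 0)^-1 *: x); first by apply: supereigenZ; rewrite ?invr_gt0.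
split; last by exists i0; rewrite mxE mulVf // gt_eqF.
move=> i; rewrite mxE mulrC ler_pdivlMr // mul1r /i0.
by case: arg_minP => // j _; apply.
Qed.

(** Once x is normalised to have least entry 1 and r is at most the value [r0] of the all-ones
    vector, the feasible pairs lie in a box, and r is minimised over a compact set. *)
Lemma supereigen_min (R : realType) (k n : nat) (T : tensor R k n) :
    (0 < n)%N -> (forall it, 0 <= T it) -> weakly_irreducible T ->
  exists rho (u : 'cV[R]_n),
    supereigen T rho u /\ forall r x, supereigen T r x -> rho <= r.
Proof.
move=> n0 T0 Tirr; have [r0 hr0] := supereigen_exists n0 T0.
have r00 : 0 <= r0 := supereigen_ge0 n0 T0 hr0.
have [M HM] := weakly_irreducible_bound n0 r00 T0 Tirr.
(* A pair (r, x) is coded as one function: its value at [None] is r, its value at [Some i] is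
   x_i. *)
pose a (o : option 'I_n) : R := if o is Some i then 1 else 0.
pose b (o : option 'I_n) : R := if o is Some i then M else r0.
pose vec (f : {ptws option 'I_n -> R}) : 'cV[R]_n := \col_i f (Some i).
pose K := [set f : {ptws option 'I_n -> R} | forall o, a o <= f o <= b o] `&`
  [set f : {ptws option 'I_n -> R} |
     forall i, tensor_app T (vec f) i 0 <= f None * f (Some i) ^+ k.-1].
have clK : closed K.
  apply: closedI; first exact: closed_box.
  apply: closed_forall => i; apply: closed_le_fun.
    rewrite (_ : (fun _ => _) = fun f : {ptws option 'I_n -> R} =>
      \sum_(t : k.-1.-tuple 'I_n) T (i, t) * \prod_(j < k.-1) f (Some (tnth t j))).
      apply: continuous_sum => t _; apply: continuous_mul; first exact: cst_continuous.
      by apply: continuous_prod => j _; exact: continuous_coord.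
    apply/funext => f; rewrite tensor_appE; apply: eq_bigr => t _.
    by congr (_ * _); apply: eq_bigr => j _; rewrite mxE.
  apply: continuous_mul; first exact: continuous_coord.
  by apply: continuous_expr; exact: continuous_coord.
pose pt (r : R) (x : 'cV[R]_n) : {ptws option 'I_n -> R} :=
  fun o => if o is Some i then x i 0 else r.
have inK r x : supereigen T r x -> r <= r0 -> (forall i, 1 <= x i 0) ->
    (exists i, x i 0 = 1) -> K (pt r x).
  move=> rx le_r x1 ex1; have r_ge0 := supereigen_ge0 n0 T0 rx.
  (* The bound [M] was obtained for [r0], so the inequality is first weakened from [r] to [r0]. *)
  have r0x : supereigen T r0 x.
    move=> i; split; first exact: (rx i).1.
    by rewrite (le_trans (rx i).2) // ler_wpM2r // exprn_ge0 // ltW // (rx i).1.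
  split=> [[i|]|i] /=.
  - by rewrite x1 HM.
  - by rewrite r_ge0 le_r.
  - rewrite (_ : vec _ = x); first exact: (rx i).2.
    by apply/colP => j; rewrite mxE.
have K0 : K !=set0.
  exists (pt r0 (const_mx 1)); apply: inK => //.
    by move=> i; rewrite mxE.
  by exists (Ordinal n0); rewrite mxE.
have cg : continuous (fun f : {ptws option 'I_n -> R} => - f None).
  by move=> f; apply: continuousN; exact: continuous_coord.
have [f [fbox fK] fmin] := closed_box_max clK cg K0 (fun f Kf => Kf.1).
exists (f None), (vec f); split.
  move=> i; rewrite [vec f i 0]mxE; split; last exact: fK.
  by have /andP[/(lt_le_trans ltr01)] := fbox (Some i).
move=> r x rx; have [le_r|/ltW le_r] := leP r r0; last first.
  by apply: le_trans le_r; have /andP[] := fbox None.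
have [y ry [y1 ey1]] := supereigen_normalize n0 rx.
by have := fmin _ (inK r y ry le_r y1 ey1); rewrite lerN2.
Qed.

Theorem perron_vector (R : realType) (k n : nat) (T : tensor R k n) :
    (0 < n)%N -> (forall it, 0 <= T it) -> weakly_irreducible T ->
  exists rho (u : 'cV[R]_n),
    (forall i, 0 < u i 0) /\ tensor_app T u = rho *: hadamard_pow u k.-1.
Proof.
move=> n0 T0 Tirr; have [rho [x [rx rho_min]]] := supereigen_min n0 T0 Tirr.
have [u ru [all_s|no_s]] := supereigen_dichotomy T0 Tirr rx.
  have [r' lt_r r'u] := supereigen_all_strict n0 ru all_s.
  by have := rho_min _ _ r'u; rewrite leNgt lt_r.
exists rho, u; split=> [i|]; first exact: (ru i).1.
apply/colP => i; apply/eqP; rewrite 2![in eqbRHS]mxE eq_le (ru i).2 /=.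
by have := no_s i; rewrite inE -leNgt.
Qed.

(** * Complex tensors dominated by a nonnegative tensor *)

(** Let c be the largest ratio y_i / u_i. Then y <= c u, with equality at some i0, and monotonicity
    of T at i0 gives mu <= rho. If mu = rho, an arc from a tight coordinate to a slack one would
    make the inequality at the tight one contradictory, so every coordinate is tight. *)
Lemma subeigen_le (R : realFieldType) (k n : nat) (T : tensor R k n) mu rho
    (y u : 'cV[R]_n) :
    (forall it, 0 <= T it) ->
    (forall i, 0 < u i 0) -> tensor_app T u = rho *: hadamard_pow u k.-1 ->
    y != 0 -> (forall i, 0 <= y i 0) ->
    (forall i, mu * y i 0 ^+ k.-1 <= tensor_app T y i 0) ->
  mu <= rho /\
  (mu = rho -> weakly_irreducible T -> exists2 c, 0 < c & y = c *: u).
Proof.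
move=> T0 u0 Tu /cV0Pn[i1 yi1] y0 mu_y.
pose i0 := [arg max_(i > i1) y i 0 / u i 0]%O; pose c := y i0 0 / u i0 0.
have cmax i : y i 0 <= c * u i 0.
  by rewrite -ler_pdivrMr // /c /i0; case: arg_maxP => // j _; apply.
have yi0 : y i0 0 = c * u i0 0 by rewrite /c divfK // gt_eqF.
have c0 : 0 < c.
  rewrite -(pmulr_lgt0 _ (u0 i1)); apply: lt_le_trans (cmax i1).
  by rewrite lt0r yi1 y0.
have Tcu i : tensor_app T (c *: u) i 0 = rho * (c * u i 0) ^+ k.-1.
  by rewrite tensor_appZ Tu !mxE mulrCA -exprMn.
have cmax' i : 0 <= y i 0 <= (c *: u) i 0 by rewrite mxE y0 cmax.
have le_Ty i : tensor_app T y i 0 <= rho * (c * u i 0) ^+ k.-1.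
  by rewrite -Tcu tensor_app_le.
split.
  have := le_trans (mu_y i0) (le_Ty i0); rewrite yi0 ler_pM2r //.
  by rewrite exprn_gt0 // mulr_gt0.
move=> mu_rho Tirr; exists c => //; apply/colP => j0; rewrite mxE; apply/eqP.
apply: contraT => neq_j0.
have Pi0 : [pred i | y i 0 == c * u i 0] i0 by rewrite /= yi0.
have [i [t [j [/eqP yi /= yj jt Tit]]]] := Tirr _ _ j0 Pi0 neq_j0.
suff : rho * y i 0 ^+ k.-1 < rho * y i 0 ^+ k.-1 by rewrite ltxx.
rewrite -{1}mu_rho; apply: le_lt_trans (mu_y i) _; rewrite yi -Tcu.
apply: (tensor_app_lt T0 cmax' _ Tit jt).
  by move=> l; rewrite mxE mulr_gt0.
by rewrite mxE lt_neqAle yj cmax.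
Qed.

Definition complex_tensor (R : realType) (k n : nat) (T : tensor R k n) :
  tensor R[i] k n := [ffun it => (T it)%:C].

Definition normc_mx (R : realType) (n : nat) (x : 'cV[R[i]]_n) : 'cV[R]_n :=
  \col_i Normc.normc (x i 0).

Lemma normc_norm (R : realType) (z : R[i]) : (Normc.normc z)%:C = `|z|.
Proof. by []. Qed.

Lemma normc_ge0 (R : realType) (z : R[i]) : 0 <= Normc.normc z.
Proof. by case: z => a b; exact: sqrtr_ge0. Qed.

Lemma normc_mx_eq0 (R : realType) (n : nat) (x : 'cV[R[i]]_n) :
  (normc_mx x == 0) = (x == 0).
Proof.
apply/eqP/eqP => [x0|->]; apply/colP => i; rewrite !mxE ?Normc.normc0 //.
by apply: Normc.eq0_normc; have := congr1 (fun y : 'cV_n => y i 0) x0; rewrite !mxE.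
Qed.

Lemma tensor_app_normc (R : realType) (k n : nat) (T : tensor R k n)
    (x : 'cV[R[i]]_n) i :
  (tensor_app T (normc_mx x) i 0)%:C =
  \sum_(t : k.-1.-tuple 'I_n) (T (i, t))%:C * \prod_(j < k.-1) `|x (tnth t j) 0|.
Proof.
rewrite tensor_appE rmorph_sum; apply: eq_bigr => t _.
by rewrite rmorphM rmorph_prod; congr (_ * _); apply: eq_bigr => j _; rewrite mxE.
Qed.

Lemma eigen_normc_le (R : realType) (k n : nat) (S : tensor R[i] k n)
    (T : tensor R k n) lambda (x : 'cV[R[i]]_n) i :
    (forall it, `|S it| <= (T it)%:C) -> is_eigenpair S lambda x ->
  Normc.normc lambda * normc_mx x i 0 ^+ k.-1 <= tensor_app T (normc_mx x) i 0.
Proof.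
move=> ST [_ /(congr1 (fun y : 'cV_n => y i 0))]; rewrite tensor_appE [in RHS]mxE.
rewrite [hadamard_pow _ _ _ _]mxE => eqS.
rewrite -lecR tensor_app_normc rmorphM rmorphXn mxE /= !normc_norm.
rewrite -normrX -normrM -eqS.
apply: le_trans (ler_norm_sum _ _ _) _; apply: ler_sum => t _.
rewrite normrM normr_prod ler_wpM2r // prodr_ge0 // => j _.
Qed.

(** The moduli of an eigenvector x for [lambda] are proportional to [u], so the triangle inequality
    in each row of S x^{k-1} = lambda x^{[k-1]} is an equality. All terms of a row then have the
    same phase, which determines every entry of S. *)
Lemma eigen_rigid (R : realType) (k n : nat) (S : tensor R[i] k n)
    (T : tensor R k n) lambda (u : 'cV[R]_n) :
    (forall it, `|S it| <= (T it)%:C) -> weakly_irreducible T ->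
    (forall i, 0 < u i 0) ->
    tensor_app T u = Normc.normc lambda *: hadamard_pow u k.-1 ->
    lambda != 0 -> Spec S lambda ->
  exists2 Gamma : 'M[R[i]]_n, unimodular_diag Gamma &
    forall it, S it = lambda / `|lambda| * diag_conj Gamma (complex_tensor T) it.
Proof.
move=> ST Tirr u0 Tu nz_lambda [x eig_x].
have T0 it : 0 <= T it by rewrite -lecR; apply: le_trans (ST it); exact: normr_ge0.
have nz_y : normc_mx x != 0 by rewrite normc_mx_eq0; case: eig_x.
have y0 i : 0 <= normc_mx x i 0 by rewrite mxE normc_ge0.
have [_ /(_ erefl Tirr)[c c0 yE]] :=
  subeigen_le T0 u0 Tu nz_y y0 (fun i => eigen_normc_le i ST eig_x).
have nz_x i : x i 0 != 0.
  rewrite -normr_eq0 -normc_norm.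
  have -> : Normc.normc (x i 0) = c * u i 0.
    by have := congr1 (fun y : 'cV_n => y i 0) yE; rewrite !mxE.
  by rewrite fmorph_eq0 gt_eqF // mulr_gt0.
(* [Gamma] consists of the inverse phases of the eigenvector. *)
exists (diag_mx (\row_i (`|x i 0| / x i 0))).
  split; first exact: diag_mx_is_diag.
  by move=> i; rewrite !mxE eqxx mulr1n normrM normfV normr_id divff // normr_eq0.
case=> i t; rewrite ffunE /= ffunE.
have [w wE] : {w | w = lambda * x i 0 ^+ k.-1} by exists (lambda * x i 0 ^+ k.-1).
have nz_w : w != 0 by rewrite wE mulf_neq0 // expf_neq0.
(* The factor [|w| / w] rotates row i of S x^{k-1}, whose sum is [w], onto the positive real axis;
   [G] dominates the moduli of the rotated terms. *)
pose F (s : k.-1.-tuple 'I_n) :=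
  S (i, s) * (\prod_(j < k.-1) x (tnth s j) 0) * (`|w| / w).
pose G (s : k.-1.-tuple 'I_n) := (T (i, s))%:C * \prod_(j < k.-1) `|x (tnth s j) 0|.
have leFG s : true -> `|F s| <= G s.
  move=> _; rewrite /F /G !normrM normfV normr_id divff ?normr_eq0 // mulr1.
  by rewrite normr_prod ler_wpM2r // prodr_ge0.
have eqFG : \sum_s F s = \sum_s G s.
  have -> : \sum_s F s = `|w|.
    rewrite -mulr_suml -tensor_appE eig_x.2 mxE [hadamard_pow _ _ _ _]mxE -wE.
    by rewrite mulrC divfK.
  rewrite -tensor_app_normc yE tensor_appZ Tu wE normrM normrX -!normc_norm.
  have -> : Normc.normc (x i 0) = (c *: u) i 0 by rewrite -yE mxE.
  by rewrite -rmorphXn -rmorphM !mxE mulrCA -exprMn.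
(* Equal sums with [F] dominated by [G] in modulus force equality term by term. *)
have := normC_sum_upper leFG eqFG (erefl : true) (i := t); rewrite /F /G.
rewrite wE normrM normrX !mxE eqxx mulr1n expr_div_n invf_div.
under [X in _ -> _ = _ * (_ * X)]eq_bigr do rewrite !mxE eqxx mulr1n.
rewrite prodf_div.
set p := \prod_(j < k.-1) x (tnth t j) 0; set q := \prod_(j < k.-1) `|_|.
set X := x i 0 ^+ k.-1; set Y := `|x i 0| ^+ k.-1; set l := `|lambda|.
have nz_p : p != 0 by apply/prodf_neq0.
have nz_X : X != 0 by rewrite expf_neq0.
have nz_Y : Y != 0 by rewrite expf_neq0 // normr_eq0.
have nz_l : l != 0 by rewrite normr_eq0.
move=> eqS; transitivity (lambda * X / (l * Y * p) * ((T (i, t))%:C * q)).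
  by rewrite -eqS; field; rewrite nz_l nz_X nz_Y nz_p nz_lambda.
by field; rewrite nz_l nz_Y nz_p.
Qed.

(** * Spectra and spectral radii *)

(** If x is an eigenvector of the conjugated tensor, then Gamma x is one of T for the same
    eigenvalue. *)
Lemma Spec_diag_conj_sub (F : fieldType) (k n : nat) (Gamma : 'M[F]_n)
    (T : tensor F k n) :
  (forall i, Gamma i i != 0) -> Spec (diag_conj Gamma T) `<=` Spec T.
Proof.
move=> nzG lambda [x [nz_x eig_x]]; exists (\col_i (Gamma i i * x i 0)); split.
  have /cV0Pn[i xi] := nz_x; apply/cV0Pn; exists i.
  by rewrite mxE mulf_neq0.
apply/colP => i; have := congr1 (fun y : 'cV_n => y i 0) eig_x.
rewrite !tensor_appE [in RHS]mxE [hadamard_pow _ _ _ _]mxE => eq_i.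
rewrite 3!mxE exprMn mulrCA -eq_i mulr_sumr; apply: eq_bigr => t _.
rewrite ffunE /= -!mulrA mulVKf ?expf_neq0 //; congr (_ * _).
by rewrite -big_split; apply: eq_bigr => j _; rewrite mxE.
Qed.

Lemma diag_conjK (F : fieldType) (k n : nat) (Gamma : 'M[F]_n) (T : tensor F k n) :
    (forall i, Gamma i i != 0) ->
  diag_conj (diag_mx (\row_i (Gamma i i)^-1)) (diag_conj Gamma T) = T.
Proof.
move=> nzG; apply/ffunP => -[i t]; rewrite !ffunE /= !mxE eqxx mulr1n exprVn invrK.
rewrite -!mulrA mulVKf ?expf_neq0 // -big_split /= big1 ?mulr1 // => j _.
by rewrite !mxE eqxx mulr1n divff.
Qed.

Lemma Spec_diag_conj (F : fieldType) (k n : nat) (Gamma : 'M[F]_n)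
    (T : tensor F k n) :
  (forall i, Gamma i i != 0) -> Spec (diag_conj Gamma T) = Spec T.
Proof.
move=> nzG; apply/seteqP; split; first exact: Spec_diag_conj_sub.
rewrite -{1}(diag_conjK T nzG); apply: Spec_diag_conj_sub => i.
by rewrite !mxE eqxx mulr1n invr_eq0.
Qed.

Lemma SpecN (F : fieldType) (k n : nat) (T : tensor F k n) :
  Spec (- T) = [set - z | z in Spec T].
Proof.
have appN (U : tensor F k n) x : tensor_app (- U) x = - tensor_app U x.
  apply/colP => i; rewrite tensor_appE [RHS]mxE tensor_appE -sumrN.
  by apply: eq_bigr => t _; rewrite ffunE mulNr.
apply/seteqP; split=> [lambda [x [nz_x eig_x]]|_ [lambda [x [nz_x eig_x]] <-]].
  exists (- lambda); last by rewrite opprK.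
  by exists x; split=> //; rewrite scaleNr -eig_x appN opprK.
by exists x; split=> //; rewrite scaleNr -eig_x appN.
Qed.

Lemma unimodular_diag_neq0 (C : numFieldType) (n : nat) (Gamma : 'M[C]_n) i :
  unimodular_diag Gamma -> Gamma i i != 0.
Proof. by move=> [_ G1]; rewrite -normr_eq0 G1 oner_eq0. Qed.

Lemma spectral_radius_max (R : realType) (k n : nat) (T : tensor R[i] k n) lambda :
    Spec T lambda ->
    (forall mu, Spec T mu -> Normc.normc mu <= Normc.normc lambda) ->
  spectral_radius T = Normc.normc lambda.
Proof.
move=> spec_l max_l; apply/eqP; rewrite eq_le; apply/andP; split.
  apply: ge_sup; first by exists (Normc.normc lambda), lambda.
  by move=> _ [mu spec_mu <-]; exact: max_l.
apply: ub_le_sup; last by exists lambda.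
by exists (Normc.normc lambda) => _ [mu spec_mu <-]; exact: max_l.
Qed.

(** * Attainment of the spectral radius by compactness of normalised eigenpairs *)

Definition continuous_complex (R : realType) (X : topologicalType) (h : X -> R[i]) :=
  continuous (fun x => complex.Re (h x)) /\ continuous (fun x => complex.Im (h x)).

Lemma continuous_complex_cst (R : realType) (X : topologicalType) (c : R[i]) :
  continuous_complex (fun _ : X => c).
Proof. by split; exact: cst_continuous. Qed.

Lemma continuous_complexD (R : realType) (X : topologicalType) (f g : X -> R[i]) :
  continuous_complex f -> continuous_complex g ->
  continuous_complex (fun x => f x + g x).
Proof.
move=> [fr fi] [gr gi]; split.
  rewrite (_ : (fun _ => _) = (fun x => complex.Re (f x) + complex.Re (g x))).
    exact: continuous_add.
  by apply/funext => x /=; case: (f x) (g x) => ? ? [].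
rewrite (_ : (fun _ => _) = (fun x => complex.Im (f x) + complex.Im (g x))).
  exact: continuous_add.
by apply/funext => x /=; case: (f x) (g x) => ? ? [].
Qed.

Lemma continuous_complexM (R : realType) (X : topologicalType) (f g : X -> R[i]) :
  continuous_complex f -> continuous_complex g ->
  continuous_complex (fun x => f x * g x).
Proof.
move=> [fr fi] [gr gi]; split.
  rewrite (_ : (fun _ => _) =
    (fun x => complex.Re (f x) * complex.Re (g x)) \-
    (fun x => complex.Im (f x) * complex.Im (g x))).
    by move=> x; apply: cvgB; [exact: (continuous_mul fr gr) | exact: (continuous_mul fi gi)].
  by apply/funext => x /=; case: (f x) (g x) => ? ? [].
rewrite (_ : (fun _ => _) =
  (fun x => complex.Re (f x) * complex.Im (g x) +
            complex.Im (f x) * complex.Re (g x))).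
  by apply: continuous_add; exact: continuous_mul.
by apply/funext => x /=; case: (f x) (g x) => ? ? [].
Qed.

Lemma continuous_complex_big (R : realType) (X : topologicalType)
    (op : R[i] -> R[i] -> R[i]) (x0 : R[i]) (J : Type) (s : seq J) (F : J -> X -> R[i]) :
    (forall f g : X -> R[i], continuous_complex f -> continuous_complex g ->
       continuous_complex (fun x => op (f x) (g x))) ->
    (forall j, continuous_complex (F j)) ->
  continuous_complex (fun x => \big[op/x0]_(j <- s) F j x).
Proof.
move=> cop cF; elim: s => [|j s IH].
  rewrite (_ : (fun _ => _) = fun _ => x0); first exact: continuous_complex_cst.
  by apply/funext => x; rewrite big_nil.
rewrite (_ : (fun _ => _) = fun x => op (F j x) (\big[op/x0]_(j <- s) F j x)).
  exact: cop.
by apply/funext => x; rewrite big_cons.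
Qed.

Lemma closed_complex_eq (R : realType) (X : topologicalType) (f g : X -> R[i]) :
  continuous_complex f -> continuous_complex g -> closed [set x | f x = g x].
Proof.
move=> [fr fi] [gr gi].
rewrite (_ : [set _ | _] =
  ([set x | complex.Re (f x) <= complex.Re (g x)] `&`
   [set x | complex.Re (g x) <= complex.Re (f x)]) `&`
  ([set x | complex.Im (f x) <= complex.Im (g x)] `&`
   [set x | complex.Im (g x) <= complex.Im (f x)])).
  by apply: closedI; apply: closedI; exact: closed_le_fun.
apply/seteqP; split=> x /= => [->|[[r1 r2] [i1 i2]]]; first by rewrite !lexx.
by apply/eqP; rewrite eq_complex !eq_le r1 r2 i1 i2.
Qed.

Lemma sqr_normcE (R : realType) (z : R[i]) :
  Normc.normc z ^+ 2 = complex.Re z ^+ 2 + complex.Im z ^+ 2.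
Proof. by case: z => a b; rewrite sqr_sqrtr // addr_ge0 // sqr_ge0. Qed.

Lemma normc_le_box (R : realType) (z : R[i]) b : Normc.normc z <= b ->
  - b <= complex.Re z <= b /\ - b <= complex.Im z <= b.
Proof.
move=> zb; have b0 : 0 <= b by exact: le_trans (normc_ge0 z) zb.
suff le_sqr p : p ^+ 2 <= Normc.normc z ^+ 2 -> - b <= p <= b.
  by split; apply: le_sqr; rewrite sqr_normcE ?lerDl ?lerDr sqr_ge0.
move=> le_p; rewrite -ler_norml; apply: le_trans zb.
by rewrite -(ler_pXn2r (n := 2)) ?nnegrE ?normc_ge0 // real_normK ?num_real.
Qed.

Lemma is_eigenpairZ (F : fieldType) (k n : nat) (T : tensor F k n) lambda c x :
  c != 0 -> is_eigenpair T lambda x -> is_eigenpair T lambda (c *: x).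
Proof.
move=> nz_c [nz_x eig_x]; split; first by rewrite scaler_eq0 negb_or nz_c.
rewrite tensor_appZ eig_x; apply/colP => i; rewrite !mxE exprMn; ring.
Qed.

Lemma eigenpair_normalize (R : realType) (k n : nat) (T : tensor R[i] k n) lambda :
    Spec T lambda ->
  exists2 x, is_eigenpair T lambda x &
    (forall i, Normc.normc (x i 0) <= 1) /\ exists i, Normc.normc (x i 0) = 1.
Proof.
move=> [x eig_x]; have /cV0Pn[i1 nz_i1] := eig_x.1.
pose i0 := [arg max_(i > i1) Normc.normc (x i 0)]%O.
have max_i0 i : Normc.normc (x i 0) <= Normc.normc (x i0 0).
  by rewrite /i0; case: arg_maxP => // j _; apply.
have n_gt0 z : z != 0 -> 0 < Normc.normc z :> R.
  by rewrite lt0r normc_ge0 andbT; apply: contra_neq => /Normc.eq0_normc.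
have nz_i0 : x i0 0 != 0.
  have := lt_le_trans (n_gt0 _ nz_i1) (max_i0 i1).
  by apply: contraTneq => ->; rewrite Normc.normc0 ltxx.
exists ((x i0 0)^-1 *: x); first by apply: is_eigenpairZ; rewrite ?invr_eq0.
split=> [i|]; last by exists i0; rewrite mxE mulVf // Normc.normc1.
rewrite mxE Normc.normcM Normc.normcV mulrC ler_pdivrMr ?mul1r //.
exact: n_gt0.
Qed.

(** Normalise the eigenvector to largest modulus 1. At a coordinate of modulus 1 the eigenvalue is
    bounded by the row sum of the moduli of the entries of T. *)
Lemma Spec_bounded (R : realType) (k n : nat) (T : tensor R[i] k n) :
    (0 < n)%N ->
  exists B, forall lambda, Spec T lambda -> Normc.normc lambda <= B.
Proof.
move=> n0; pose N : tensor R k n := [ffun it => Normc.normc (T it)].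
have N0 it : 0 <= N it by rewrite ffunE normc_ge0.
have [B feasB] := supereigen_exists n0 N0; exists B => lambda.
move=> /eigenpair_normalize[x eig_x [x1 [i xi]]].
have TN it : `|T it| <= (N it)%:C by rewrite ffunE normc_norm.
have := eigen_normc_le i TN eig_x; rewrite mxE xi expr1n mulr1 => /le_trans; apply.
have := (feasB i).2; rewrite [in leRHS]mxE expr1n mulr1; apply: le_trans.
by apply: tensor_app_le => // j; rewrite !mxE normc_ge0 x1.
Qed.

(** The spectral radius is defined as a supremum, whereas the rigidity argument needs an actual
    eigenvalue of that modulus. The modulus of the eigenvalue is maximised over a compact set of
    eigenpairs. *)
Lemma spectral_radius_attained (R : realType) (k n : nat) (T : tensor R[i] k n) :
    (0 < n)%N -> Spec T !=set0 ->
  exists2 lambda, Spec T lambda & spectral_radius T = Normc.normc lambda.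
Proof.
move=> n0 [lambda0 spec0]; have [B HB] := Spec_bounded T n0.
(* The boolean selects the real part ([true]) or the imaginary part ([false]); [None] stands for the
   eigenvalue, [Some i] for coordinate i. *)
pose I := (bool * option 'I_n)%type; pose X := {ptws I -> R}.
pose bd (o : I) : R := if o.2 is Some _ then 1 else B.
pose z o (f : X) : R[i] := f (true, o) +i* f (false, o).
pose vec (f : X) : 'cV[R[i]]_n := \col_i z (Some i) f.
have cz o : continuous_complex (z o).
  by split; exact: continuous_coord.
(* Requiring [1 <= sqn f] is a closed condition that excludes the zero vector. *)
pose sqn (f : X) : R :=
  \sum_i (f (true, Some i) ^+ 2 + f (false, Some i) ^+ 2).
pose K := [set f : X | forall o, - bd o <= f o <= bd o] `&`
  ([set f : X | forall i,
     tensor_app T (vec f) i 0 = z None f * \prod_(j < k.-1) z (Some i) f] `&`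
   [set f : X | 1 <= sqn f]).
have clK : closed K.
  apply: closedI; first exact: closed_box.
  apply: closedI.
    apply: closed_forall => i; apply: closed_complex_eq.
      rewrite (_ : (fun _ => _) = fun f : X => \sum_(t : k.-1.-tuple 'I_n)
        T (i, t) * \prod_(j < k.-1) z (Some (tnth t j)) f).
        apply: continuous_complex_big => [|t]; first exact: continuous_complexD.
        apply: continuous_complexM; first exact: continuous_complex_cst.
        by apply: continuous_complex_big => [|j]; [exact: continuous_complexM | exact: cz].
      apply/funext => f; rewrite tensor_appE; apply: eq_bigr => t _.
      by congr (_ * _); apply: eq_bigr => j _; rewrite mxE.
    apply: continuous_complexM; first exact: cz.
    by apply: continuous_complex_big => [|j]; [exact: continuous_complexM | exact: cz].
  apply: closed_le_fun; first exact: cst_continuous.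
  apply: continuous_sum => i _.
  by apply: continuous_add; apply: continuous_expr; exact: continuous_coord.
pose pt lambda (x : 'cV[R[i]]_n) : X := fun o =>
  let w := if o.2 is Some i then x i 0 else lambda in
  if o.1 then complex.Re w else complex.Im w.
have zpt lambda x : z None (pt lambda x) = lambda.
  by rewrite /z /pt /=; case: lambda.
have vpt lambda x : vec (pt lambda x) = x.
  by apply/colP => i; rewrite mxE /z /pt /=; case: (x i 0).
have inK lambda : Spec T lambda -> exists2 f, K f & z None f = lambda.
  move=> spec_l; have [x eig_x [x1 [i0 xi0]]] := eigenpair_normalize spec_l.
  exists (pt lambda x); last exact: zpt.
  split=> [[b [i|]]|].
  - by rewrite /pt /bd /=; have [] := normc_le_box (x1 i); case: b.
  - by rewrite /pt /bd /=; have [] := normc_le_box (HB _ spec_l); case: b.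
  split=> [i|] /=.
    rewrite vpt eig_x.2 mxE [hadamard_pow _ _ _ _]mxE zpt.
    rewrite prodr_const card_ord; congr (_ * _ ^+ _).
    by rewrite -{1}(vpt lambda x) mxE.
  rewrite /sqn (bigD1 i0) //= -[leLHS]addr0 lerD //.
    by rewrite -sqr_normcE xi0 expr1n.
  by apply: sumr_ge0 => i _; rewrite addr_ge0 // sqr_ge0.
(* The squared modulus of the eigenvalue is polynomial in the coordinates and has the same
   maximisers as the modulus. *)
pose g (f : X) : R := f (true, None) ^+ 2 + f (false, None) ^+ 2.
have gE f : g f = Normc.normc (z None f) ^+ 2 by rewrite sqr_normcE.
have cg : continuous g.
  by apply: continuous_add; apply: continuous_expr; exact: continuous_coord.
have K0 : K !=set0 by have [f Kf _] := inK _ spec0; exists f.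
have [f [_ [eig_f nz_f]] fmax] := closed_box_max clK cg K0 (fun f Kf => Kf.1).
have spec_f : Spec T (z None f).
  exists (vec f); split.
    apply: contraTneq nz_f => vec0; rewrite /sqn big1 ?ler10 // => i _.
    have := congr1 (fun y : 'cV_n => y i 0) vec0; rewrite !mxE => -[-> ->].
    by rewrite expr0n addr0.
  apply/colP => i; rewrite eig_f mxE [hadamard_pow _ _ _ _]mxE mxE.
  by rewrite prodr_const card_ord.
exists (z None f) => //; apply: spectral_radius_max => // mu /inK[h Kh <-].
by rewrite -(ler_pXn2r (n := 2)) ?nnegrE ?normc_ge0 // -!gE; exact: fmax.
Qed.

(** The Perron vector, read over the complex numbers, is an eigenvector for [rho], and [subeigen_le]
    bounds every other eigenvalue. The nonzero entry makes [rho] positive. *)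
Lemma perron_spectral_radius (R : realType) (k n : nat) (T : tensor R k n) it0 :
    (forall it, 0 <= T it) -> T it0 != 0 -> weakly_irreducible T ->
  exists rho (u : 'cV[R]_n),
    [/\ 0 < rho, forall i, 0 < u i 0, tensor_app T u = rho *: hadamard_pow u k.-1,
        Spec (complex_tensor T) rho%:C & spectral_radius (complex_tensor T) = rho].
Proof.
case: it0 => i0 t0 T0 nz_T Tirr.
have n0 : (0 < n)%N by exact: leq_ltn_trans (ltn_ord i0).
have [rho [u [u0 Tu]]] := perron_vector n0 T0 Tirr.
have rho0 : 0 < rho.
  rewrite -(pmulr_lgt0 rho (exprn_gt0 k.-1 (u0 i0))).
  have := congr1 (fun y : 'cV_n => y i0 0) Tu.
  rewrite tensor_appE [in RHS]mxE [hadamard_pow _ _ _ _]mxE => <-.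
  rewrite (bigD1 t0) //= ltr_pwDl //.
    by rewrite mulr_gt0 ?prodr_gt0 // lt0r nz_T T0.
  by apply: sumr_ge0 => t _; rewrite mulr_ge0 // prodr_ge0 // => j _; exact: ltW.
have nc_rho : Normc.normc rho%:C = rho.
  by rewrite /= expr0n addr0 sqrtr_sqr ger0_norm // ltW.
have spec_rho : Spec (complex_tensor T) rho%:C.
  exists (map_mx (real_complex R) u); split.
    apply/cV0Pn; exists i0; rewrite mxE fmorph_eq0 gt_eqF //.
  apply/colP => i.
  have : (tensor_app T u i 0)%:C = ((rho *: hadamard_pow u k.-1) i 0)%:C by rewrite Tu.
  rewrite tensor_appE rmorph_sum [in RHS]mxE [hadamard_pow _ _ _ _]mxE rmorphM rmorphXn.
  move=> eqTu; rewrite tensor_appE [RHS]mxE [hadamard_pow _ _ _ _]mxE [in RHS]mxE -eqTu.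
  apply: eq_bigr => t _; rewrite ffunE rmorphM rmorph_prod; congr (_ * _).
  by apply: eq_bigr => j _; rewrite mxE.
exists rho, u; split=> //; rewrite -[RHS]nc_rho; apply: spectral_radius_max => // mu.
move=> [x eig_x]; rewrite nc_rho.
have dom it : `|complex_tensor T it| <= (T it)%:C.
  by rewrite ffunE ger0_norm // lecR.
have nz_x : normc_mx x != 0 by rewrite normc_mx_eq0 eig_x.1.
have x0 i : 0 <= normc_mx x i 0 by rewrite mxE normc_ge0.
by have [] := subeigen_le T0 u0 Tu nz_x x0 (fun i => eigen_normc_le i dom eig_x).
Qed.

Lemma spectral_radius_rigid (R : realType) (k n : nat) (S : tensor R[i] k n)
    (T : tensor R k n) lambda it0 :
    (forall it, `|S it| <= (T it)%:C) -> T it0 != 0 -> weakly_irreducible T ->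
    Spec S lambda -> Normc.normc lambda = spectral_radius (complex_tensor T) ->
  exists2 Gamma : 'M[R[i]]_n, unimodular_diag Gamma &
    forall it, S it = lambda / `|lambda| * diag_conj Gamma (complex_tensor T) it.
Proof.
move=> dom nz_T Tirr spec_l l_rho.
have T0 it : 0 <= T it by rewrite -lecR; apply: le_trans (dom it); exact: normr_ge0.
have [rho [u [rho0 u0 Tu _ rhoE]]] := perron_spectral_radius T0 nz_T Tirr.
apply: (eigen_rigid dom Tirr u0) => //; first by rewrite l_rho rhoE.
by apply: contraTneq rho0 => l0; rewrite -rhoE -l_rho l0 Normc.normc0 ltxx.
Qed.

(** * Tensors of a connected hypergraph *)

Lemma edge_tuple (n k : nat) (e : {set 'I_n}) u :
    #|e| = k -> u \in e ->
  exists t : k.-1.-tuple 'I_n, uniq (u :: t) /\ u :: t =i e.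
Proof.
move=> card_e ue.
have sz : size (enum (e :\ u)%SET) == k.-1.
  by rewrite -cardE -card_e (cardsD1 u e) ue.
exists (Tuple sz); split=> [|v] /=.
  by rewrite enum_uniq mem_enum !inE eqxx.
by rewrite inE mem_enum !inE; case: eqP => [->|].
Qed.

Lemma adjacency_edge (F : fieldType) (n k : nat) (E : {set {set 'I_n}}) e u
    (t : k.-1.-tuple 'I_n) :
  e \in E -> u :: t =i e -> adjacency_tensor F k E (u, t) = (k.-1)`!%:R^-1.
Proof.
move=> eE te; rewrite ffunE /=.
by rewrite (_ : [set v in u :: t]%SET = e) ?eE //; apply/setP => v; rewrite inE te.
Qed.

Lemma connect_crossing (T : finType) (r : rel T) (P : pred T) x y :
    connect r x y -> P x -> ~~ P y ->
  exists u v, [/\ r u v, P u & ~~ P v].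
Proof.
move=> /connectP[p]; elim: p x => [|z p IH] x /=; first by move=> _ -> ->.
move=> /andP[rxz path_p] y_last Px nPy.
have [Pz|nPz] := boolP (P z); first exact: IH path_p y_last Pz nPy.
by exists x, z.
Qed.

Section HypergraphPerron.
Variables (n k : nat) (E : {set {set 'I_n}}).
Hypotheses (hk : (2 <= k)%N) (hunif : uniform k E).
Hypotheses (hconn : connected_hypergraph E).

Lemma adjacency_ge0 (R : realType) it : 0 <= adjacency_tensor R k E it.
Proof. by rewrite ffunE; case: ifP => // _; rewrite invr_ge0. Qed.

Lemma degree_tensor_ge0 (R : realType) it : 0 <= degree_tensor R k E it.
Proof. by rewrite ffunE; case: ifP. Qed.

Lemma factorial_unit (F : numFieldType) : (k.-1)`!%:R^-1 != 0 :> F.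
Proof. by rewrite invr_eq0 pnatr_eq0 -lt0n fact_gt0. Qed.

Lemma adjacency_irreducible (R : realType) :
  weakly_irreducible (adjacency_tensor R k E).
Proof.
move=> P i0 j0 Pi0 nPj0.
have [u [v [/exists_inP[e eE /andP[ue ve]] Pu nPv]]] :=
  connect_crossing (hconn i0 j0) Pi0 nPj0.
have [t [_ te]] := edge_tuple (hunif eE) ue.
exists u, t, v; split=> //.
  have := te v; rewrite ve inE; case: eqP => // vu.
  by rewrite vu Pu in nPv.
by rewrite (adjacency_edge _ eE te) factorial_unit.
Qed.

Lemma signless_irreducible (R : realType) :
  weakly_irreducible (signless_laplacian_tensor R k E).
Proof.
move=> P i0 j0 Pi0 nPj0.
have [i [t [j [Pi nPj jt At]]]] := @adjacency_irreducible R P i0 j0 Pi0 nPj0.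
exists i, t, j; split=> //; rewrite ffunE gt_eqF // ltr_wpDl ?degree_tensor_ge0 //.
by rewrite lt0r At adjacency_ge0.
Qed.

Lemma complex_adjacency (R : realType) :
  complex_tensor (adjacency_tensor R k E) = adjacency_tensor R[i] k E.
Proof.
apply/ffunP => it; rewrite !ffunE; case: ifP => _; last exact: rmorph0.
by rewrite fmorphV rmorph_nat.
Qed.

Lemma complex_signless (R : realType) :
  complex_tensor (signless_laplacian_tensor R k E) =
  signless_laplacian_tensor R[i] k E.
Proof.
apply/ffunP => it; rewrite ffunE ffunE [RHS]ffunE rmorphD; congr (_ + _).
  by rewrite !ffunE; case: ifP => _; rewrite ?rmorph0 // rmorph_nat.
by rewrite -complex_adjacency [RHS]ffunE.
Qed.

Lemma laplacian_dominated (R : realType) it :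
  `|laplacian_tensor R[i] k E it| <= (signless_laplacian_tensor R k E it)%:C.
Proof.
have -> : (signless_laplacian_tensor R k E it)%:C =
    degree_tensor R[i] k E it + adjacency_tensor R[i] k E it.
  by have := congr1 (fun T : tensor _ _ _ => T it) (complex_signless R); rewrite !ffunE.
rewrite ffunE [X in `|_ + X|]ffunE; apply: le_trans (ler_normB _ _) _.
rewrite !ger0_norm //.
  by rewrite ffunE; case: ifP => // _; rewrite invr_ge0.
by rewrite ffunE; case: ifP.
Qed.

(** At a diagonal position the factors Gamma_ii^{-(k-1)} and Gamma_ii^{k-1} cancel; elsewhere the
    tensor vanishes. *)
Lemma diag_conj_degree (F : fieldType) (Gamma : 'M[F]_n) :
    (forall i, Gamma i i != 0) ->
  diag_conj Gamma (degree_tensor F k E) = degree_tensor F k E.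
Proof.
move=> nzG; apply/ffunP => -[i t]; rewrite !ffunE /=; case: ifP => [/all_tnthP it|_].
  rewrite (eq_bigr (fun _ => Gamma i i)) => [|j _]; last by rewrite (eqP (it j)).
  by rewrite prodr_const card_ord mulrAC mulVf ?mul1r // expf_neq0.
by rewrite mulr0 mul0r.
Qed.

Lemma diag_conjD (F : fieldType) (Gamma : 'M[F]_n) (T U : tensor F k n) :
  diag_conj Gamma (T + U) = diag_conj Gamma T + diag_conj Gamma U.
Proof. by apply/ffunP => it; rewrite !ffunE mulrDr mulrDl. Qed.

Lemma laplacian_conj_iff (F : fieldType) (Gamma : 'M[F]_n) :
    (forall i, Gamma i i != 0) ->
  laplacian_tensor F k E = diag_conj Gamma (signless_laplacian_tensor F k E) <->
  - adjacency_tensor F k E = diag_conj Gamma (adjacency_tensor F k E).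
Proof.
move=> nzG; rewrite /laplacian_tensor /signless_laplacian_tensor diag_conjD.
by rewrite diag_conj_degree //; split=> [/addrI|->].
Qed.

Hypothesis hE : E != finset.set0.

Lemma edge_exists : exists e u v, [/\ e \in E, u \in e, v \in e & u != v].
Proof.
have /set0Pn[e eE] := hE; exists e.
have : (1 < #|e|)%N by rewrite (hunif eE).
by move=> /card_gt1P[u [v [ue ve uv]]]; exists u, v.
Qed.

Lemma adjacency_neq0 (R : realType) : exists it, adjacency_tensor R k E it != 0.
Proof.
have [e [u [_ [eE ue _ _]]]] := edge_exists.
have [t [_ te]] := edge_tuple (hunif eE) ue.
by exists (u, t); rewrite (adjacency_edge _ eE te) factorial_unit.
Qed.

Lemma signless_neq0 (R : realType) :
  exists it, signless_laplacian_tensor R k E it != 0.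
Proof.
have [it nz_it] := adjacency_neq0 R; exists it.
rewrite ffunE gt_eqF // ltr_wpDl ?degree_tensor_ge0 //.
by rewrite lt0r nz_it adjacency_ge0.
Qed.

(** An edge has at least two vertices, so there is a vertex other than [i], and a path towards it
    leaves [i] through an edge. *)
Lemma degree_gt0 i : (0 < degree E i)%N.
Proof.
have [e [u [v [_ _ _ uv]]]] := edge_exists.
have [j ij] : exists j, ~~ pred1 i j.
  by have [ui|ui] := eqVneq u i; [exists v; rewrite /= -ui eq_sym | exists u].
have [i' [w [/exists_inP[e' e'E /andP[ie' _]] /eqP ii' _]]] :=
  connect_crossing (P := pred1 i) (hconn i j) (eqxx i) ij.
by apply/card_gt0P; exists e'; rewrite inE e'E -ii'.
Qed.

Lemma laplacian_conj_signless (R : realType) :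
    spectral_radius (laplacian_tensor R[i] k E) =
    spectral_radius (signless_laplacian_tensor R[i] k E) ->
  exists Gamma : 'M[R[i]]_n, unimodular_diag Gamma /\
    laplacian_tensor R[i] k E =
    diag_conj Gamma (signless_laplacian_tensor R[i] k E).
Proof.
set L := laplacian_tensor _ _ _; rewrite -complex_signless => eq_rho.
have Qirr := @signless_irreducible R.
have [it0 nz_Q] := signless_neq0 R.
have Q0 it : 0 <= signless_laplacian_tensor R k E it.
  by rewrite ffunE addr_ge0 // ?degree_tensor_ge0 ?adjacency_ge0.
have [rho [_ [rho0 _ _ _ rhoE]]] := perron_spectral_radius Q0 nz_Q Qirr.
(* The supremum of the empty set is 0, so an empty spectrum would give radius 0, against rho(Q) >
   0. *)
have nz_spec : Spec L !=set0.
  apply/set0P; apply: contraTneq rho0 => spec0.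
  by rewrite -rhoE -eq_rho /spectral_radius spec0 image_set0 sup0 ltxx.
have n0 : (0 < n)%N by exact: leq_ltn_trans (ltn_ord it0.1).
have [lambda spec_l l_rho] := spectral_radius_attained n0 nz_spec.
have [|Gamma uG LE] := spectral_radius_rigid (@laplacian_dominated R) nz_Q Qirr spec_l.
  by rewrite -l_rho.
have nzG i := unimodular_diag_neq0 i uG.
exists Gamma; split=> //; rewrite complex_signless.
suff l1 : lambda / `|lambda| = 1.
  by apply/ffunP => it; rewrite LE l1 mul1r complex_signless.
(* At a diagonal position L and Q both equal the degree, which is positive and fixed by conjugation,
   so the phase of [lambda] is 1. The adjacency entry there is 0 because an edge has at least two
   vertices. *)
pose it1 := (it0.1, nseq_tuple k.-1 it0.1).
have all_t : all (pred1 it0.1) (nseq_tuple k.-1 it0.1) by rewrite all_pred1_nseq.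
have A0 : adjacency_tensor R[i] k E it1 = 0.
  rewrite ffunE; case: ifP => // /hunif card_k; move: hk; rewrite -card_k.
  rewrite (_ : [set _ in _]%SET = [set it0.1]%SET) ?cards1 //.
  apply/setP => v; rewrite !inE /= mem_nseq.
  by case: eqP => //=; rewrite andbF.
have := LE it1; rewrite complex_signless.
rewrite diag_conjD diag_conj_degree // ffunE [X in _ + X = _]ffunE A0.
rewrite [X in _ = _ * X]ffunE [X in _ = _ * (_ + X)]ffunE A0 mulr0 mul0r subr0 addr0.
rewrite ffunE /= all_t => /esym; rewrite -[RHS]mul1r => /mulIf; apply.
by rewrite pnatr_eq0 -lt0n degree_gt0.
Qed.

Lemma adjacency_spectral_radius_mem (R : realType) :
  0 < spectral_radius (adjacency_tensor R[i] k E) /\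
  Spec (adjacency_tensor R[i] k E) (spectral_radius (adjacency_tensor R[i] k E))%:C.
Proof.
have [it0 nz_A] := adjacency_neq0 R.
have [rho [_ [rho0 _ _ spec_rho rhoE]]] :=
  perron_spectral_radius (@adjacency_ge0 R) nz_A (@adjacency_irreducible R).
by rewrite -complex_adjacency rhoE.
Qed.

Lemma adjacency_conj_opp (R : realType) :
    Spec (adjacency_tensor R[i] k E)
      (- (spectral_radius (adjacency_tensor R[i] k E))%:C) ->
  exists Gamma : 'M[R[i]]_n, unimodular_diag Gamma /\
    - adjacency_tensor R[i] k E = diag_conj Gamma (adjacency_tensor R[i] k E).
Proof.
have [rho0 _] := adjacency_spectral_radius_mem R.
move: rho0; set rho := spectral_radius _ => rho0 spec_rho.
have [it0 nz_A] := adjacency_neq0 R.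
have dom it : `|adjacency_tensor R[i] k E it| <= (adjacency_tensor R k E it)%:C.
  rewrite -complex_adjacency ffunE ger0_norm // lecR; exact: adjacency_ge0.
have absE : `|- rho%:C| = rho%:C :> R[i] by rewrite normrN ger0_norm // lecR ltW.
have [|Gamma uG AE] :=
  spectral_radius_rigid dom nz_A (@adjacency_irreducible R) spec_rho.
  rewrite complex_adjacency -/rho.
  by rewrite normcN /= expr0n addr0 sqrtr_sqr ger0_norm // ltW.
exists Gamma; split=> //; apply/ffunP => it; rewrite ffunE AE absE complex_adjacency.
by rewrite mulNr divff ?mulN1r ?opprK // fmorph_eq0 gt_eqF.
Qed.

Lemma real_conj_odd_bipartite (R : realType) (Gamma : 'M[R[i]]_n) :
    ~~ odd k -> unimodular_diag Gamma -> Gamma \is a mxOver Num.real ->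
    - adjacency_tensor R[i] k E = diag_conj Gamma (adjacency_tensor R[i] k E) ->
  odd_bipartite E.
Proof.
move=> k_even [_ G1] /mxOverP Greal conjA.
have sqrG i : Gamma i i ^+ 2 = 1 by rewrite -real_normK // G1 expr1n.
have G_pm i : Gamma i i = (-1) ^+ (Gamma i i != 1).
  have /orP[/eqP ->|/eqP ->] : (Gamma i i == 1) || (Gamma i i == -1).
  - by rewrite -sqrf_eq1 sqrG.
  - by rewrite eqxx.
  - by rewrite eqNr oner_eq0.
(* [V] collects the vertices of sign -1, so the product of [Gamma] over an edge is -1 exactly when
   the edge meets [V] in an odd number of vertices; as k is even, it then meets the complement oddly
   too. *)
pose V := [set i | Gamma i i != 1]%SET.
exists (~: V)%SET, V; split; first by rewrite finset.setUC finset.setUCr.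
  by rewrite -setI_eq0 finset.setIC finset.setICr.
move=> e eE.
suff oddV : odd #|(e :&: V)%SET|.
  split=> //; have := cardsID V e; rewrite (hunif eE) finset.setDE.
  by move: k_even => /[swap] <-; rewrite oddD oddV /= negbK.
have /card_gt0P[u ue] : (0 < #|e|)%N by rewrite (hunif eE) ltnW.
have [t [uniq_t te]] := edge_tuple (hunif eE) ue.
have := congr1 (fun T : tensor _ _ _ => T (u, t)) conjA.
rewrite ffunE [RHS]ffunE /= !(adjacency_edge _ eE te).
have nzG i : Gamma i i != 0 by rewrite -normr_eq0 G1 oner_eq0.
have prodG : \prod_(v in e) Gamma v v = (-1) ^+ #|(e :&: V)%SET|.
  rewrite (bigID (mem V)) /= [X in _ * X]big1 => [|v /andP[_]]; last first.
    by rewrite inE negbK => /eqP.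
  rewrite mulr1 -prodr_const; apply: eq_big => [v|v /andP[_]].
    by rewrite finset.in_setI.
  by rewrite inE => Gv; rewrite G_pm Gv expr1.
rewrite mulrAC -[LHS]mulN1r => /(mulIf (factorial_unit _)) eqG.
(* The entry (u, t) says that the product over [t] is -Gamma_uu^{k-1}. Multiplying by Gamma_uu gives
   -Gamma_uu^k, which is -1 for even k. *)
have : \prod_(v in e) Gamma v v = -1.
  rewrite -(eq_bigl _ _ te) -big_uniq //= big_cons big_tuple.
  have -> : \prod_(j < k.-1) Gamma (tnth t j) (tnth t j) = - Gamma u u ^+ k.-1.
    by rewrite -[LHS](mulVKf (expf_neq0 k.-1 (nzG u))) -eqG mulrN1.
  rewrite mulrN -exprS prednK; last exact: ltnW.
  by rewrite -(odd_double_half k) (negPf k_even) add0n -mul2n exprM sqrG expr1n.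
rewrite prodG -signr_odd; case: (odd _) => // /eqP.
by rewrite expr0 -addr_eq0 (pnatr_eq0 _ 2).
Qed.

End HypergraphPerron.

(** * The cycle of implications between the six conditions, and non-reality of [Gamma] *)

Theorem theorem3p2 (R : realType) (n k : nat) (E : {set {set 'I_n}})
    (hk : (2 <= k)%N) (k_even : ~~ odd k)
    (hunif : uniform k E) (hconn : connected_hypergraph E)
    (hnob : ~ odd_bipartite E) :
  let A : tensor R[i] k n := adjacency_tensor R[i] k E in
  let L : tensor R[i] k n := laplacian_tensor R[i] k E in
  let Q : tensor R[i] k n := signless_laplacian_tensor R[i] k E in
  [<-> spectral_radius L = spectral_radius Q;
       exists Gamma : 'M[R[i]]_n,
         unimodular_diag Gamma /\ L = diag_conj Gamma Q;
       Spec L = Spec Q;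
       exists Gamma : 'M[R[i]]_n,
         unimodular_diag Gamma /\ - A = diag_conj Gamma A;
       Spec A = [set - z | z in Spec A];
       Spec A (- (spectral_radius A)%:C)]
  /\ (forall Gamma : 'M[R[i]]_n, unimodular_diag Gamma ->
        L = diag_conj Gamma Q \/ - A = diag_conj Gamma A ->
        Gamma \isn't a mxOver Num.real).
Proof.
move=> A L Q.
(* With no edge, the partition into all vertices and none would be an odd bipartition. *)
have hE : E != finset.set0.
  apply/eqP => E0; apply: hnob; exists [set: 'I_n]%SET, finset.set0.
  split; [exact: finset.setU0 | by rewrite -setI_eq0 finset.setI0 | move=> e].
  by rewrite E0 inE.
have LQA Gamma : unimodular_diag Gamma ->
    L = diag_conj Gamma Q <-> - A = diag_conj Gamma A.
  by move=> uG; apply: laplacian_conj_iff => i; exact: unimodular_diag_neq0.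
have Spec_conj Gamma (T : tensor R[i] k n) :
    unimodular_diag Gamma -> Spec (diag_conj Gamma T) = Spec T.
  by move=> uG; apply: Spec_diag_conj => i; exact: unimodular_diag_neq0.
have conj_LQ : spectral_radius L = spectral_radius Q ->
    exists Gamma : 'M[R[i]]_n, unimodular_diag Gamma /\ L = diag_conj Gamma Q.
  exact: laplacian_conj_signless.
split; last first.
  move=> Gamma uG hG; apply/negP => Greal; apply: hnob.
  apply: (real_conj_odd_bipartite hk hunif k_even uG Greal).
  by case: hG => // /(LQA _ uG).
tfae=> //.
- by move=> [Gamma [uG ->]]; exact: Spec_conj.
(* From (3) to (4) through (1) and (2): equal spectra have equal radii, and the degree part of L and
   Q cancels. *)
- move=> specLQ; have [|Gamma [uG LE]] := conj_LQ.
    by rewrite /spectral_radius specLQ.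
  by exists Gamma; split=> //; apply/(LQA _ uG).
- by move=> [Gamma [uG AE]]; rewrite -SpecN AE Spec_conj.
(* By symmetry of the spectrum it suffices that rho(A) itself is an eigenvalue, which is the Perron
   statement. *)
- move=> ->; exists (spectral_radius A)%:C => //.
  by have [] := adjacency_spectral_radius_mem hk hunif hconn hE R.
- move=> /(adjacency_conj_opp hk hunif hconn hE)[Gamma [uG /(LQA _ uG) ->]].
  by rewrite /spectral_radius Spec_conj.
Qed.
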